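(* Let $\delta\ge0$. Suppose $(\mu_x\mid x\in[0,\delta])$ is a 1-parameter family of finite r-measures on an open set $D\subseteq\overline{\mathbf{R}}^2$. Suppose that for all $x,y\in[0,\delta]$ the box inequality $$\mu_x(R)\le\mu_y(R^{|y-x|})$$ holds for all rectangles $R$ whose $|y-x|$-thickening $R^{|y-x|}$ belongs to $\mathrm{Rect}(D)$. Then there exists a $\delta$-matching between the undecorated diagrams $(\mathrm{dgm}(\mu_0),D)$ and $(\mathrm{dgm}(\mu_\delta),D)$.
   Context: $\overline{\mathbf{R}}=[-\infty,+\infty]$. For $D\subseteq\overline{\mathbf{R}}^2$, $\mathrm{Rect}(D)$ is the set of rectangles $[a,b]\times[c,d]\subseteq D$ with $-\infty\le a<b\le+\infty$ and $-\infty\le c<d\le+\infty$. An r-measure on $D$ is a function $\mu:\mathrm{Rect}(D)\to\{0,1,2,\dots\}\cup\{\infty\}$ such that, whenever $[a,b]\times[c,d]\in\mathrm{Rect}(D)$, $a<p<b$ and $c<q<d$, $\mu([a,b]\times[c,d])=\mu([a,p]\times[c,d])+\mu([p,b]\times[c,d])$ and $\mu([a,b]\times[c,d])=\mu([a,b]\times[c,q])+\mu([a,b]\times[q,d])$. It is finite if $\mu(R)<\infty$ for all $R\in\mathrm{Rect}(D)$. The $\eta$-thickening of $R=[a,b]\times[c,d]$ is $R^\eta=[a-\eta,b+\eta]\times[c-\eta,d+\eta]$, with $\pm\infty$ unchanged by adding or subtracting $\eta$. Decorated numbers are symbols $p^+,p^-$ ($p\in\mathbf{R}$) together with $-\infty^+$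 and $+\infty^-$; they are ordered, jointly with the extended reals, by $p^-<p<p^+$, and $p^+<q^-$ whenever $p<q$, with $-\infty<-\infty^+$ and $+\infty^-<+\infty$ the extreme elements. A decorated point $(p^*,q^* )$ belongs to $[a,b]\times[c,d]$ if $a<p^*<b$ and $c<q^*<d$. For a finite r-measure $\mu$ on $D$ there is a unique multiset $\mathrm{Dgm}(\mu)$ of decorated points, each belonging to some rectangle in $\mathrm{Rect}(D)$, such that for every $R\in\mathrm{Rect}(D)$ the number of points of $\mathrm{Dgm}(\mu)$ (with multiplicity) belonging to $R$ is $\mu(R)$. The undecorated diagram $\mathrm{dgm}(\mu)$ is the multiset in the interior of $D$ ($=D$, as $D$ is open) obtained by forgetting decorations and keeping only the points that lie in the interior of $D$. $\mathrm{d}^\infty((p,q),(r,s))=\max(|p-r|,|q-s|)$ on $\overline{\mathbf{R}}^2$, where equal infinite coordinates contribute $0$ and the distance is $\infty$ if some coordinate is infinite in one point and not equal to the corresponding coordinate of the other. For $\alpha\in D$ the exit distance is $\mathrm{ex}^\infty(\alpha,D)=\min\{\mathrm{d}^\infty(\alpha,x)\mid x\in\overline{\mathbf{R}}^2-D\}$ (and $\infty$ if $D=\overline{\mathbf{R}}^2$). Multisets are regarded as sets by labelling repeated copies of points. For multisets $A,B$ in $D$, a $\delta$-matching between $(A,D)$ and $(B,D)$ is a subset $M\subset A\times B$ in which each element of $A$ and of $B$ occurs in at most one pair, such that $\mathrm{d}^\infty(\alpha,\beta)\le\delta$ for all $(\alpha,\beta)\in M$, and $\mathrm{ex}^\infty(\gamma,D)\le\delta$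 for every unmatched $\gamma$ in $A$ or $B$. *)

(* Defs.v *)
From mathcomp Require Import all_boot all_order all_algebra.
From mathcomp Require Import all_classical all_reals all_analysis.

Set Implicit Arguments.
Unset Strict Implicit.
Unset Printing Implicit Defensive.

Import Order.TTheory GRing.Theory Num.Theory.
Import numFieldNormedType.Exports.

Local Open Scope classical_set_scope.
Local Open Scope ring_scope.
Local Open Scope ereal_scope.

(* {0, 1, 2, ...} with infinity adjoined, the latter being None. *)
Definition natbar := option nat.

Definition addnb (m n : natbar) : natbar :=
  match m, n with
  | Some m', Some n' => Some (m' + n')%N
  | _, _ => None
  end.

Definition lenb (m n : natbar) : bool :=
  match m, n with
  | _, None => true
  | None, Some _ => false
  | Some m', Some n' => (m' <= n')%N
  end.

Definition has_card (T : Type) (A : set T) (n : natbar) : Prop :=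
  match n with
  | Some k => (A #= `I_k)%card
  | None => infinite_set A
  end.

(* A multiset is given by its multiplicity function. *)
Definition multiset (T : Type) := T -> natbar.

(* The multiset regarded as a set: the copies of x are labelled (x, 0),
   (x, 1), ..., there being m x of them. *)
Definition copies (T : Type) (m : multiset T) : set (T * nat) :=
  [set c | lenb (Some c.2.+1) (m c.1)].

(* A quadruple (a, b, c, d), standing for [a, b] x [c, d]. *)
Record rect (R : realType) := MkRect {
  left_ : \bar R; right_ : \bar R; bot_ : \bar R; top_ : \bar R }.

Definition proper_rect (R : realType) (r : rect R) : Prop :=
  left_ r < right_ r /\ bot_ r < top_ r.

Definition rect_set (R : realType) (r : rect R) : set (\bar R * \bar R) :=
  [set z | left_ r <= z.1 <= right_ r /\ bot_ r <= z.2 <= top_ r].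

Definition Rect (R : realType) (D : set (\bar R * \bar R)) : set (rect R) :=
  [set r | proper_rect r /\ rect_set r `<=` D].

Definition thicken (R : realType) (eta : R) (r : rect R) : rect R :=
  MkRect (left_ r - eta%:E) (right_ r + eta%:E)
         (bot_ r - eta%:E) (top_ r + eta%:E).

(* The values of mu outside Rect D are irrelevant. *)
Definition r_measure (R : realType) (D : set (\bar R * \bar R))
    (mu : rect R -> natbar) : Prop :=
  forall a b c d p q : \bar R, Rect D (MkRect a b c d) ->
    a < p < b -> c < q < d ->
    mu (MkRect a b c d) = addnb (mu (MkRect a p c d)) (mu (MkRect p b c d)) /\
    mu (MkRect a b c d) = addnb (mu (MkRect a b c q)) (mu (MkRect a b q d)).

Definition finite_r_measure (R : realType) (D : set (\bar R * \bar R))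
    (mu : rect R -> natbar) : Prop :=
  r_measure D mu /\ forall r, Rect D r -> mu r <> None.

(* Decorated numbers p^-, p^+, (-oo)^+ and (+oo)^-. *)
Inductive dnum (R : realType) :=
  | DMinus of R
  | DPlus of R
  | DNInfPlus
  | DPInfMinus.

Arguments DNInfPlus {R}.
Arguments DPInfMinus {R}.

Definition undecorate (R : realType) (x : dnum R) : \bar R :=
  match x with
  | DMinus p => p%:E
  | DPlus p => p%:E
  | DNInfPlus => -oo
  | DPInfMinus => +oo
  end.

Definition is_plus (R : realType) (x : dnum R) : bool :=
  match x with
  | DPlus _ | DNInfPlus => true
  | DMinus _ | DPInfMinus => false
  end.

(* a < x and x < b in the joint order on extended reals and decorated numbers:
   p^- and p^+ lie immediately below and immediately above p. *)
Definition lt_ext_dec (R : realType) (a : \bar R) (x : dnum R) : bool :=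
  (a < undecorate x) || ((a == undecorate x) && is_plus x).

Definition lt_dec_ext (R : realType) (x : dnum R) (b : \bar R) : bool :=
  (undecorate x < b) || ((undecorate x == b) && ~~ is_plus x).

Definition dpoint (R : realType) : Type := (dnum R * dnum R)%type.

Definition dpoint_in (R : realType) (z : dpoint R) (r : rect R) : Prop :=
  [/\ lt_ext_dec (left_ r) z.1, lt_dec_ext z.1 (right_ r),
      lt_ext_dec (bot_ r) z.2 & lt_dec_ext z.2 (top_ r)].

Definition is_Dgm (R : realType) (D : set (\bar R * \bar R))
    (mu : rect R -> natbar) (m : multiset (dpoint R)) : Prop :=
  (forall c, copies m c -> exists2 r, Rect D r & dpoint_in c.1 r) /\
  (forall r, Rect D r ->
    has_card (copies m `&` [set c | dpoint_in c.1 r]) (mu r)).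

(* The multiset characterised by is_Dgm, which for a finite r-measure exists and
   is unique; the empty multiset is a dummy default. *)
Definition Dgm (R : realType) (D : set (\bar R * \bar R))
    (mu : rect R -> natbar) : multiset (dpoint R) :=
  xget (fun=> Some 0%N) [set m | is_Dgm D mu m].

(* The decorated numbers x with undecorate x = p. *)
Definition decorations (R : realType) (p : \bar R) : seq (dnum R) :=
  match p with
  | p'%:E => [:: DMinus p'; DPlus p']
  | -oo => [:: DNInfPlus]
  | +oo => [:: DPInfMinus]
  end.

Definition dgm (R : realType) (D : set (\bar R * \bar R))
    (mu : rect R -> natbar) : multiset (\bar R * \bar R) :=
  fun z => if `[< interior D z >] then
      \big[addnb/Some 0%N]_(x <- decorations z.1)
        \big[addnb/Some 0%N]_(y <- decorations z.2) Dgm D mu (x, y)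
    else Some 0%N.

(* The test for equality is needed at infinity, where subtraction gives
   +oo - +oo = -oo. *)
Definition dcoord (R : realType) (p q : \bar R) : \bar R :=
  if p == q then 0 else `|p - q|.

Definition dinfty (R : realType) (z w : \bar R * \bar R) : \bar R :=
  maxe (dcoord z.1 w.1) (dcoord z.2 w.2).

(* For D open the infimum is attained unless D is the whole extended plane, in
   which case it is ereal_inf set0 = +oo. *)
Definition exit_dist (R : realType) (z : \bar R * \bar R)
    (D : set (\bar R * \bar R)) : \bar R :=
  ereal_inf [set dinfty z w | w in ~` D].

Definition delta_matching (R : realType) (D : set (\bar R * \bar R))
    (delta : R) (A B : multiset (\bar R * \bar R))
    (M : set (((\bar R * \bar R) * nat) * ((\bar R * \bar R) * nat))) : Prop :=
  [/\ M `<=` copies A `*` copies B,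
      (forall a b b', M (a, b) -> M (a, b') -> b = b') /\
      (forall a a' b, M (a, b) -> M (a', b) -> a = a'),
      forall a b, M (a, b) -> dinfty a.1 b.1 <= delta%:E,
      forall a, copies A a -> ~ (exists b, M (a, b)) ->
        exit_dist a.1 D <= delta%:E &
      forall b, copies B b -> ~ (exists a, M (a, b)) ->
        exit_dist b.1 D <= delta%:E].

(* Main.v *)
(* The proof interpolates along the family.  The box inequality, applied to
   rectangles shrinking to a closed d^oo-ball, bounds the number of points of
   dgm(mu_x) in the ball of radius r around z by the number of points of dgm(mu_y)
   in the ball of radius r + |y - x|, as long as the larger ball lies in D.  Since
   the diagrams are locally finite, for y close to x this lets each point of
   dgm(mu_x) be followed to nearby points of dgm(mu_y) injectively, at unit speed;
   a supremum argument then moves any finite set of points of dgm(mu_0) with exit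
   distance greater than delta injectively into dgm(mu_delta), by at most delta.
   A compactness argument removes the finiteness, and the injections obtained in
   the two directions are merged into one matching as in the Cantor-Bernstein
   theorem. *)
Require Import Defs.
From mathcomp Require Import all_boot all_order all_algebra.
From mathcomp Require Import all_classical all_reals all_analysis.
From mathcomp Require Import finmap ring lra.

Set Implicit Arguments.
Unset Strict Implicit.
Unset Printing Implicit Defensive.

Import Order.TTheory GRing.Theory Num.Theory.
Import numFieldNormedType.Exports.

Local Open Scope classical_set_scope.
Local Open Scope ring_scope.

(** * Selection and merging of injections *)

(** This lets finitely many conditions that hold eventually be imposed at once. The type
    [{classic I}] equips an arbitrary index type with the choice structure that finite sets of the
    library require. *)
Lemma filter_finite_bigI (T I : Type) (F : set_system T) (E : set I)
    (f : I -> set T) :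
  Filter F -> finite_set E -> (forall i, E i -> F (f i)) ->
  F (\bigcap_(i in E) f i).
Proof.
move=> FF Efin Ff; pose E' : set {classic I} := E.
have E'fin : finite_set E' by [].
have -> : E = [set` fset_set E'] by rewrite fset_setK.
apply: (@filter_bigI _ {classic I}) => i.
by rewrite in_fset_set// => /set_mem; exact: Ff.
Qed.

(** If no fibre over [C] were in [F], all their complements would be; the intersection of these
    finitely many complements with the preimage of [C] is empty. *)
Lemma ultra_finite_fiber (T U : Type) (F : set_system T) (f : T -> U)
    (C : set U) :
  UltraFilter F -> finite_set C -> F (f @^-1` C) ->
  exists2 u, C u & F (f @^-1` [set u]).
Proof.
move=> FU Cfin FC; apply: contrapT => H.
have /(filterI FC) : F (\bigcap_(u in C) ~` (f @^-1` [set u])).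
  apply: filter_finite_bigI => // u Cu.
  by have [Fu|//] := in_ultra_setVsetC (f @^-1` [set u]) FU; case: H; exists u.
by move=> /filter_ex[x [Cx /(_ _ Cx)]]; exact.
Qed.

(* Rado's selection principle: an ultrafilter on the finite subsets of A picks
   out one value for each point from the finitely many candidates. *)
Lemma injective_selection (T U : Type) (A : set T) (C : T -> set U) :
  (forall a, A a -> finite_set (C a)) ->
  (forall F, finite_set F -> F `<=` A ->
     exists f : T -> U, set_inj F f /\ (forall a, F a -> C a (f a))) ->
  exists f : T -> U, set_inj A f /\ (forall a, A a -> C a (f a)).
Proof.
move=> Cfin sel.
have [h hP] : {h : set T -> T -> U & forall F, finite_set F -> F `<=` A ->
    set_inj F (h F) /\ (forall a, F a -> C a (h F a))}.
  apply: (@choice _ _ (fun F h => finite_set F -> F `<=` A ->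
    set_inj F h /\ forall a, F a -> C a (h a))) => F.
  have [FP|nFP] := pselect (finite_set F /\ F `<=` A).
    by have [f fP] := sel F FP.1 FP.2; exists f.
  (* [U] may be empty, so the dummy function also has to come from [sel]. *)
  have [f _] := sel set0 (finite_set0 T) (@sub0set _ A).
  by exists f => Ffin FA; case: nFP.
pose fsub := [set F | finite_set F /\ F `<=` A].
(* A property holds along [G] when it holds for all sufficiently large finite subsets of [A]. *)
pose G := filter_from fsub (fun F0 => fsub `&` [set F | F0 `<=` F]).
have GP : ProperFilter G.
  apply: filter_from_proper; last by move=> F [Ffin FA]; exists F; split.
  apply: filter_from_filter; first by exists set0; split; [exact: finite_set0|].
  move=> E F [Ef EA] [Ff FA]; exists (E `|` F).
    by split; [rewrite finite_setU|move=> x [/EA|/FA]].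
  by move=> K [KA KEF]; split; split=> // x xEF; apply: KEF; [left|right].
have [U' [U'U GU']] := ultraFilterLemma GP.
have in1 a : A a -> U' (fsub `&` [set F | F a]).
  move=> Aa; apply: GU'; exists [set a].
    by split; [exact: finite_set1|move=> x ->].
  by move=> F [FA aF]; split=> //; exact: aF.
have [g gP] : {g : T -> U & forall a, A a -> C a (g a) /\
    U' [set F | h F a = g a]}.
  apply: (@choice _ _ (fun a u => A a -> C a u /\ U' [set F | h F a = u])) => a.
  have [Aa|nAa] := pselect (A a); last first.
    by exists (h set0 a).
  have [|u Cu Uu] := @ultra_finite_fiber _ _ U' (h ^~ a) (C a) U'U (Cfin _ Aa).
    apply: filterS (in1 _ Aa) => F [[Ff FA] Fa].
    by have [_] := hP F Ff FA; exact.
  by exists u.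
exists g; split; last by move=> a /gP[].
move=> a b /set_mem Aa /set_mem Ab gab.
(* Some finite [F] contains both points and has [h F] agreeing with [g] at both, so injectivity of
   [h F] on [F] decides. *)
have [F [[[[Ff FA] Fa] [_ Fb]] [ha hb]]] := filter_ex (filterI
  (filterI (in1 _ Aa) (in1 _ Ab)) (filterI (gP _ Aa).2 (gP _ Ab).2)).
have [hinj _] := hP F Ff FA.
apply: (hinj a b); [exact: mem_set|exact: mem_set|].
exact: etrans ha (etrans gab (esym hb)).
Qed.

(* The argument of the Cantor-Bernstein theorem: follow f on the points
   reachable from A minus the range of g, and g elsewhere. *)
Lemma matching_merge (T U : Type) (A : set T) (B : set U)
    (f : T -> U) (g : U -> T) :
  set_inj A f -> set_inj B g ->
  exists M : set (T * U),
    [/\ forall a b, M (a, b) -> (A a /\ b = f a) \/ (B b /\ a = g b),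
        forall a b b', M (a, b) -> M (a, b') -> b = b',
        forall a a' b, M (a, b) -> M (a', b) -> a = a',
        forall a, A a -> exists b, M (a, b) &
        forall b, B b -> exists a, M (a, b)].
Proof.
move=> finj ginj.
(* Since [f] need not map [A] into [B], nor [g] map [B] into [A], closure under [g] after [f] is
   required only while the orbit stays inside the two sets. *)
pose closed (K : set T) := A `\` (g @` B) `<=` K /\
  forall c, K c -> B (f c) -> A (g (f c)) -> K (g (f c)).
pose C := [set a | A a /\ forall K, closed K -> K a].
have C0 a : A a -> ~ (g @` B) a -> C a.
  by move=> Aa na; split=> // K [K0 _]; apply: K0.
have CS c : C c -> B (f c) -> A (g (f c)) -> C (g (f c)).
  by move=> [Ac cK] Bf Ag; split=> // K Kc; apply: Kc.2 => //; exact: cK.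
(* Minimality of [C]: the elements of [C] with this property already form a closed set. *)
have Cinv b : B b -> C (g b) -> exists2 c, C c & b = f c.
  move=> Bb [_ /(_ [set a | C a /\ forall b, B b -> a = g b ->
    exists2 c, C c & b = f c])].
  case=> [|_]; last exact.
  split=> [a [Aa na]|c [Cc _] Bf Ag].
    by split=> [|b' Bb' ab']; [exact: C0|case: na; exists b'].
  split=> [|b' Bb' gb']; first exact: CS.
  by exists c => //; exact: ginj (mem_set Bb') (mem_set Bf) (esym gb').
exists [set c | (C c.1 /\ c.2 = f c.1) \/
  (B c.2 /\ c.1 = g c.2 /\ ~ exists2 x, C x & c.2 = f x)].
split=> /=.
- by move=> a b [[[Aa _] ->]|[Bb [-> _]]]; [left|right].
- move=> a b b' [[Ca ->]|[Bb [ab nb]]] [[Ca' ->]|[Bb' [ab' nb']]] //.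
  + by case: nb'; apply: Cinv => //; rewrite -ab'.
  + by case: nb; apply: Cinv => //; rewrite -ab.
  + by apply: ginj; rewrite ?in_setE// -ab.
- move=> a a' b [[Ca ->]|[Bb [-> nb]]] [[Ca' fa]|[Bb' [ab' nb']]] //.
  + exact: finj (mem_set Ca.1) (mem_set Ca'.1) fa.
  + by case: nb'; exists a.
  + by case: nb; exists a'.
- move=> a Aa; have [Ca|nCa] := pselect (C a); first by exists (f a); left.
  have [[b Bb gb]|na] := pselect ((g @` B) a); last by case: nCa; exact: C0.
  exists b; right; split=> //; split=> // -[c Cc bf]; apply: nCa.
  by rewrite -gb bf; apply: CS; rewrite -?bf ?gb.
- move=> b Bb; have [[c Cc bc]|nb] := pselect (exists2 x, C x & b = f x).
    by exists c; left.
  by exists (g b); right.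
Qed.

(** Injections chosen separately on the fibres of [p] glue to a global one, because target sets of
    different fibres are disjoint. It assigns targets to clusters of points in one time step. *)
Lemma injection_fiberwise (T V : Type) (U : pointedType) (F : set T)
    (p : T -> V) (G : V -> set U) :
  (forall c, F c -> (F `&` [set c' | p c' = p c] #<= G (p c))%card) ->
  (forall c c' u, F c -> F c' -> G (p c) u -> G (p c') u -> p c = p c') ->
  exists f : T -> U, set_inj F f /\ (forall c, F c -> G (p c) (f c)).
Proof.
move=> leG disj.
have [h hP] : {h : V -> T -> U & forall v, (exists2 c, F c & p c = v) ->
    set_inj (F `&` [set c' | p c' = v]) (h v) /\
    (forall c, F c -> p c = v -> G v (h v c))}.
  apply: (@choice _ _ (fun v h => (exists2 c, F c & p c = v) ->
    set_inj (F `&` [set c' | p c' = v]) h /\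
    (forall c, F c -> p c = v -> G v (h c)))) => v.
  have [[c Fc <-]|] := pselect (exists2 c, F c & p c = v); last first.
    by exists (fun=> point).
  have /pcard_leP/injfunPex[h hfun hinj] := leG c Fc.
  by exists h => _; split=> // c' Fc' pc'; exact: hfun.
exists (fun c => h (p c) c); split.
  move=> c c' /set_mem Fc /set_mem Fc' hcc'.
  have [cinj cG] := hP (p c) (ex_intro2 _ _ c Fc erefl).
  have [_ c'G] := hP (p c') (ex_intro2 _ _ c' Fc' erefl).
  have pcc' : p c = p c'.
    apply: (disj c c' (h (p c) c)) => //; first exact: cG.
    by rewrite hcc'; exact: c'G.
  by apply: cinj; rewrite ?hcc' ?pcc'//; exact: mem_set.
by move=> c Fc; have [_] := hP (p c) (ex_intro2 _ _ c Fc erefl); exact.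
Qed.

(** * The extended metric *)

Section ExtendedMetric.
Variable R : realType.
Implicit Types (p q : \bar R) (z w : \bar R * \bar R) (r s e : R).

Lemma dcoordxx p : dcoord p p = 0%E.
Proof. by rewrite /dcoord eqxx. Qed.

Lemma dcoordC p q : dcoord p q = dcoord q p.
Proof.
rewrite /dcoord eq_sym; case: eqP => // _.
by case: p q => [p||] [q||]//=; rewrite distrC.
Qed.

Lemma dcoord_le_fin (x y r : R) : (dcoord x%:E y%:E <= r%:E)%E = (`|x - y| <= r).
Proof.
rewrite /dcoord; case: eqP => [[->]|_]; last by [].
by rewrite subrr normr0.
Qed.

Lemma dcoord_triangle p q u r s :
  (dcoord p q <= r%:E -> dcoord q u <= s%:E -> dcoord p u <= (r + s)%:E)%E.
Proof.
case: p q u => [p||] [q||] [u||]//; rewrite ?dcoordxx ?dcoord_le_fin ?lee_fin//.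
- by move=> pq qu; rewrite (le_trans (ler_distD q _ _))// lerD.
- exact: addr_ge0.
- exact: addr_ge0.
Qed.

Lemma dcoord_gt0 p q : p != q -> (0 < dcoord p q)%E.
Proof.
rewrite /dcoord => /negbTE /[dup] pq ->.
case: p q pq => [p||] [q||]//= pq; rewrite lte_fin normr_gt0 subr_eq0.
by apply: contraFN pq => /eqP ->.
Qed.

Lemma dinfty_le z w r :
  (dinfty z w <= r%:E)%E = (dcoord z.1 w.1 <= r%:E)%E && (dcoord z.2 w.2 <= r%:E)%E.
Proof. by rewrite /dinfty ge_max. Qed.

Lemma dinftyxx z : dinfty z z = 0%E.
Proof. by rewrite /dinfty !dcoordxx maxxx. Qed.

Lemma dinftyC z w : dinfty z w = dinfty w z.
Proof. by rewrite /dinfty dcoordC [X in maxe _ X]dcoordC. Qed.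

Lemma dinfty_triangle z w v r s :
  (dinfty z w <= r%:E -> dinfty w v <= s%:E -> dinfty z v <= (r + s)%:E)%E.
Proof.
rewrite !dinfty_le => /andP[zw1 zw2] /andP[wv1 wv2].
by rewrite (dcoord_triangle zw1)//= (dcoord_triangle zw2).
Qed.

Lemma near_dinfty_gt z w : z <> w ->
  \forall e \near 0^'+, ~ (dinfty z w <= e%:E)%E.
Proof.
move=> zw; have : (0 < dinfty z w)%E.
  rewrite /dinfty lt_max; apply/orP.
  have [zw1|zw1] := eqVneq z.1 w.1; last by left; exact: dcoord_gt0.
  right; apply: dcoord_gt0; apply/eqP => zw2; apply: zw.
  by rewrite [z]surjective_pairing zw1 zw2 -surjective_pairing.
case: (dinfty z w) => [d||]//; last first.
  by move=> _; near=> e.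
rewrite lte_fin => d0; near=> e; apply/negP; rewrite -ltNge lte_fin.
by near: e; exact: nbhs_right_lt.
Unshelve. all: by end_near. Qed.

Lemma near_double (P : R -> Prop) :
  (\forall e \near 0^'+, P e) -> \forall e \near 0^'+, P (e + e).
Proof.
move=> [e /= e0 eP]; exists (e / 2) => /=; first by rewrite divr_gt0.
move=> x /=; rewrite sub0r normrN => xe x0; apply: eP; last exact: addr_gt0.
rewrite /= sub0r normrN ger0_norm; last by rewrite ltW// addr_gt0.
by rewrite gtr0_norm// in xe; lra.
Qed.

(** A ball of finite radius about a point with an infinite coordinate keeps that coordinate fixed,
    so these balls need not be neighbourhoods in the extended plane. *)
Definition dball z r : set (\bar R * \bar R) := [set w | (dinfty z w <= r%:E)%E].

Lemma dball_center z r : 0 <= r -> dball z r z.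
Proof. by move=> r0; rewrite /dball/= dinftyxx lee_fin. Qed.

Lemma dball0 z : dball z 0 = [set z].
Proof.
apply/seteqP; split=> [w /= zw|w ->]; last exact: dball_center.
apply: contrapT => /nesym/near_dinfty_gt nzw.
have [e [e0 /negP]] := filter_ex (filterI (nbhs_right_gt 0) nzw).
by rewrite (le_trans zw)// lee_fin ltW.
Qed.

Lemma subset_dball z w r s :
  (dinfty z w <= s%:E)%E -> dball w r `<=` dball z (s + r).
Proof. by move=> zw v; exact: dinfty_triangle. Qed.

Lemma le_dball z r s : r <= s -> dball z r `<=` dball z s.
Proof. by move=> rs w /le_trans; apply; rewrite lee_fin. Qed.

End ExtendedMetric.

(** * Following points along the family *)

Section Following.
Variables (R : realType) (delta : R) (D : set (\bar R * \bar R)).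
Notation lpoint := (((\bar R * \bar R) * nat)%type).
(** The labelled diagrams enter only through the hypotheses below, so that the same argument serves
    for the family run backwards. *)
Variable A : R -> set lpoint.
Hypothesis D_dball : forall z, D z -> \forall e \near 0^'+, dball z e `<=` D.
Hypothesis A_sub : forall t c, 0 <= t <= delta -> A t c -> D c.1.
Hypothesis A_finite : forall t z r, 0 <= t <= delta -> 0 <= r ->
  dball z r `<=` D -> finite_set (A t `&` [set c | dball z r c.1]).
Hypothesis A_le : forall s t z r, 0 <= s <= delta -> 0 <= t <= delta ->
  0 <= r -> dball z (r + `|t - s|) `<=` D ->
  (A s `&` [set c | dball z r c.1]
     #<= A t `&` [set c | dball z (r + `|t - s|) c.1])%card.

(** A small ball about [z] inside [D] holds finitely many points, and each one not located at [z] is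
    excluded by shrinking the radius. *)
Lemma near_isolated t z : 0 <= t <= delta -> D z ->
  \forall e \near 0^'+, A t `&` [set c | dball z e c.1] `<=` [set c | c.1 = z].
Proof.
move=> tdelta Dz.
have [e0 [e0_gt0 e0D]] := filter_ex (filterI (nbhs_right_gt 0) (D_dball Dz)).
pose N := A t `&` [set c | dball z e0 c.1] `&` [set c | c.1 <> z].
have Nfin : finite_set N by apply/finite_setIl/A_finite => //; exact: ltW.
have : \forall e \near 0^'+, (\bigcap_(c in N) [set e | ~ dball z e c.1]) e.
  by apply: filter_finite_bigI => // c [_ /nesym]; exact: near_dinfty_gt.
move=> NE; near=> e => c [Ac ce] /=; apply: contrapT => cz.
have : (\bigcap_(c in N) [set e | ~ dball z e c.1]) e by near: e.
move=> /(_ c); apply=> //; split=> //; split=> //.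
by apply: le_dball ce; near: e; exact: nbhs_right_le.
Unshelve. all: by end_near. Qed.

Section FiniteSet.
Variable F : set lpoint.
Hypothesis F_finite : finite_set F.
Hypothesis F_dball : forall a, F a -> dball a.1 delta `<=` D.

Let reach t := exists f : lpoint -> lpoint, set_inj F f /\
  (forall a, F a -> A t (f a) /\ dball a.1 t (f a).1).

(** For small [e] the [e]-balls about the distinct locations of [f @] F[are disjoint, and by the
    ball inequality each contains at least as many points of]A (t + e)[as its centre has copies in]f
    @[F]. *)
Let reach_right t : 0 <= t < delta -> reach t ->
  \forall e \near 0^'+, reach (t + e).
Proof.
move=> /andP[t0 tdelta] [f [finj fA]].
pose G := f @` F.
have Gfin : finite_set (G `*` G) by apply: finite_setX; exact: finite_image.
have sep : \forall e \near 0^'+, (\bigcap_(cc in G `*` G)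
    [set e | cc.1.1 <> cc.2.1 -> ~ dball cc.1.1 (e + e) cc.2.1]) e.
  apply: filter_finite_bigI => //= -[c c'] _ /=.
  have [->|cc'] := pselect (c.1 = c'.1); first by near=> e.
  by have := near_double (near_dinfty_gt cc'); apply: filterS => e ? _.
near=> e.
have e0 : 0 < e by near: e; exact: nbhs_right_gt.
have te : t + e <= delta.
  by rewrite addrC -lerBrDr; near: e; apply: nbhs_right_le; rewrite subr_gt0.
have tD : 0 <= t <= delta by rewrite t0 ltW.
have teD : 0 <= t + e <= delta by rewrite te andbT addr_ge0// ltW.
have eE : `|t + e - t| = e by rewrite addrAC subrr add0r gtr0_norm.
have [||g [ginj gA]] := @injection_fiberwise lpoint _ lpoint G fst
    (fun v => A (t + e) `&` [set c | dball v e c.1]).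
- move=> c [a Fa fac]; have [Ac ac] := fA _ Fa; rewrite fac in Ac ac.
  (* At radius 0 the left side of the inequality counts the copies located at [c.1]. *)
  have := @A_le t (t + e) c.1 0 tD teD (lexx _).
  have cD : dball c.1 e `<=` D.
    apply: subset_trans (F_dball Fa); apply: subset_trans (le_dball te).
    exact: subset_dball.
  rewrite dball0 eE add0r => /(_ cD); apply: card_le_trans.
  apply: subset_card_le => _ [[b Fb <-] /= bc]; split=> //.
  by have [] := fA _ Fb.
- move=> c c' u Gc Gc' [_ cu] [_ c'u]; apply: contrapT => cc'.
  have : (\bigcap_(cc in G `*` G)
    [set e | cc.1.1 <> cc.2.1 -> ~ dball cc.1.1 (e + e) cc.2.1]) e by near: e.
  move=> /(_ (c, c') (conj Gc Gc')); apply=> //.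
  by apply: dinfty_triangle cu _; rewrite dinftyC.
- exists (g \o f); split.
    move=> a b aF bF gfab; apply: finj => //; apply: ginj => //.
      by apply: mem_set; exists a => //; exact: set_mem.
    by apply: mem_set; exists b => //; exact: set_mem.
  move=> a Fa; have [_ afa] := fA _ Fa.
  have [Agfa fga] : (A (t + e) `&` [set c | dball (f a).1 e c.1]) (g (f a)).
    by apply: gA; exists a.
  by split=> //; exact: dinfty_triangle afa fga.
Unshelve. all: by end_near. Qed.

(** For small [e] each point of [f @] F[has a point of]A t[within]e[. The points of]f @[F] assigned
    to one location [v] lie in the [e]-ball about [v], hence are at most as many as the points of
    [A t] in the ball of radius [e + e], which are all copies at [v]. *)
Let reach_left t : 0 < t <= delta ->
  \forall e \near 0^'+, reach (t - e) -> reach t.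
Proof.
move=> /andP[t0 tdelta].
have tD : 0 <= t <= delta by rewrite tdelta ltW.
(* [N] holds all possible targets and is fixed before [f], so the bound on [e] depends on [t] alone.
   The supremum argument needs this uniformity. *)
pose N := \bigcup_(a in F) (A t `&` [set c | dball a.1 t c.1]).
have Nfin : finite_set N.
  apply: bigcup_finite => // a Fa; apply: A_finite => //; first exact: ltW.
  by apply: subset_trans (F_dball Fa); exact: le_dball.
have iso : \forall e \near 0^'+, (\bigcap_(c in N) [set e |
    dball c.1 (e + e) `<=` D /\
    A t `&` [set c' | dball c.1 (e + e) c'.1] `<=` [set c' | c'.1 = c.1]]) e.
  apply: filter_finite_bigI => // c [a Fa [Ac ac]].
  have Dc : D c.1 by exact: A_sub Ac.
  exact: filterI (near_double (D_dball Dc)) (near_double (near_isolated tD Dc)).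
near=> e => -[f [finj fA]].
have e0 : 0 < e by near: e; exact: nbhs_right_gt.
have te : e <= t by near: e; exact: nbhs_right_le.
have isoe : (\bigcap_(c in N) [set e |
    dball c.1 (e + e) `<=` D /\
    A t `&` [set c' | dball c.1 (e + e) c'.1] `<=` [set c' | c'.1 = c.1]]) e.
  by near: e.
have teD : 0 <= t - e <= delta.
  by rewrite subr_ge0 te (le_trans _ tdelta)// gerBl ltW.
have eE : `|t - (t - e)| = e by rewrite opprB addrCA subrr addr0 gtr0_norm.
pose G := f @` F.
have [p pP] : {p : lpoint -> (\bar R * \bar R) & forall c, G c ->
    dball c.1 e (p c) /\ exists2 b, N b & b.1 = p c}.
  apply: (@choice _ _ (fun c v => G c ->
    dball c.1 e v /\ exists2 b, N b & b.1 = v)) => c.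
  have [[a Fa fac]|nGc] := pselect (G c); last by exists c.1.
  have [Ac ac] := fA _ Fa; rewrite fac in Ac ac.
  have ceD : dball c.1 e `<=` dball a.1 t.
    by have := subset_dball (r := e) ac; rewrite subrK.
  (* The point [c] itself makes the left side nonempty, so the [e]-ball about it cannot be free of
     points of [A t]. *)
  have := @A_le (t - e) t c.1 0 teD tD (lexx _).
  rewrite dball0 eE add0r.
  move=> /(_ (subset_trans ceD (subset_trans (le_dball tdelta) (F_dball Fa)))).
  have [[b [Ab cb]] _|] := pselect (A t `&` [set c' | dball c.1 e c'.1] !=set0).
    by exists b.1 => _; split=> //; exists b => //; exists a => //; split=> //;
      exact: ceD.
  move=> /set0P/negP/negPn/eqP -> /card_le0P/seteqP[/(_ c) + _].
  by case.
have [||g [ginj gA]] := @injection_fiberwise lpoint _ lpoint G p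
    (fun v => A t `&` [set c | c.1 = v]).
- move=> c Gc; have [cp [b Nb bp]] := pP _ Gc.
  have [bD biso] := isoe b Nb.
  have := @A_le (t - e) t b.1 e teD tD (ltW e0).
  rewrite eE => /(_ bD) le; rewrite -bp.
  apply: card_le_trans (subset_card_le _).
  apply: card_le_trans le; apply: subset_card_le.
  move=> c' [Gc' pc']; have [c'p _] := pP _ Gc'.
  have [a' Fa' fa'] := Gc'; split; first by rewrite -fa'; have [] := fA _ Fa'.
  by rewrite /dball /= dinftyC -pc'.
  by move=> x [Ax bx]; split=> //; apply: biso.
- by move=> c c' u _ _ [_ <-] [_ <-].
- exists (g \o f); split.
    move=> a b aF bF gfab; apply: finj => //; apply: ginj => //.
      by apply: mem_set; exists a => //; exact: set_mem.
    by apply: mem_set; exists b => //; exact: set_mem.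
  move=> a Fa; have [_ afa] := fA _ Fa.
  have Gfa : G (f a) by exists a.
  have [Agfa gp] := gA _ Gfa; have [fp _] := pP _ Gfa.
  split=> //; rewrite gp; have := dinfty_triangle afa fp.
  by rewrite subrK.
Unshelve. all: by end_near. Qed.

(** The supremum of the reachable times is reachable by [reach_left], and by [reach_right] it cannot
    be less than [delta]. *)
Lemma finite_follow : 0 <= delta -> F `<=` A 0 -> reach delta.
Proof.
move=> delta0 FA.
pose S := [set t | 0 <= t <= delta /\ reach t].
have S0 : S 0.
  split; first by rewrite lexx delta0.
  exists id; split=> [//|a Fa]; split; first exact: FA.
  exact: dball_center.
have Sub : ubound S delta by move=> t [/andP[]].
have Ssup : has_sup S by split; [exists 0|exists delta].
have s0 : 0 <= sup S by exact: ub_le_sup Ssup.2 _ S0.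
have sdelta : sup S <= delta by apply: ge_sup => //; exists 0.
have reach_sup : reach (sup S).
  (* There is no room to the left of time 0, where the identity serves instead. *)
  have [s_eq0|s_neq0] := eqVneq (sup S) 0; first by rewrite s_eq0; case: S0.
  have s_gt0 : 0 < sup S by rewrite lt_neqAle eq_sym s_neq0.
  have [|e /= e0 eP] := reach_left (t := sup S); first by rewrite s_gt0.
  have [t [tdelta rt] st] := sup_adherent e0 Ssup.
  have ts : t <= sup S by apply: ub_le_sup => //; exact: Ssup.2.
  have [->//|t_neq] := eqVneq (sup S) t.
  have tlt : t < sup S by rewrite lt_neqAle eq_sym t_neq.
  apply: (eP (sup S - t)); last by rewrite subKr.
    rewrite /= sub0r normrN gtr0_norm ?subr_gt0//.
    by rewrite ltrBlDr addrC -ltrBlDr.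
  by rewrite subr_gt0.
have [->//|s_neq] := eqVneq delta (sup S).
have slt : sup S < delta by rewrite lt_neqAle sdelta eq_sym s_neq.
have rs : \forall e \near 0^'+, reach (sup S + e).
  by apply: reach_right => //; rewrite s0.
have sd : 0 < delta - sup S by rewrite subr_gt0.
have [e [[re e0] ed]] := filter_ex (filterI (filterI rs (nbhs_right_gt 0))
  (nbhs_right_le sd)).
have : sup S + e <= sup S.
  apply: ub_le_sup; first exact: Ssup.2.
  split=> //; rewrite addr_ge0//=; last exact: ltW.
  by rewrite addrC -lerBrDr.
by rewrite gerDl leNgt e0.
Qed.

End FiniteSet.

(** The candidates for [a] are the points of [A delta] in the ball of radius [delta] about [a]; that
    ball lies in [D], so they are finitely many and the selection principle applies. *)
Lemma follow : 0 <= delta -> exists f : lpoint -> lpoint,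
  let A0 := A 0 `&` [set a | dball a.1 delta `<=` D] in
  set_inj A0 f /\ (forall a, A0 a -> A delta (f a) /\ dball a.1 delta (f a).1).
Proof.
move=> delta_ge0.
have [||f [finj fA]] := @injective_selection lpoint lpoint
    (A 0 `&` [set a | dball a.1 delta `<=` D])
    (fun a => A delta `&` [set b | dball a.1 delta b.1]).
- by move=> a [_ aD]; apply: A_finite => //; rewrite delta_ge0 lexx.
- move=> F Ffin FA.
  have [||f [finj fA]] := finite_follow Ffin _ delta_ge0.
  + by move=> a /FA[].
  + by move=> a /FA[].
  + by exists f.
- by exists f.
Qed.

End Following.

(** * Existence of the decorated diagram *)

Section Cardinality.
Local Open Scope card_scope.

Lemma has_card_finite (T : Type) (A : set T) k :
  has_card A (Some k) -> finite_set A.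
Proof. by move=> Ak; exists k. Qed.

Lemma has_card_eq (T U : Type) (A : set T) (B : set U) k :
  has_card A (Some k) -> has_card B (Some k) -> A #= B.
Proof. by move=> Ak Bk; exact/(card_eq_trans Ak)/card_esym. Qed.

Lemma has_card_le (T U : Type) (A : set T) (B : set U) j k :
  has_card A (Some j) -> has_card B (Some k) -> (j <= k)%N -> A #<= B.
Proof.
move=> Aj Bk jk; rewrite (card_le_eql Aj) (card_le_eqr Bk) card_le_II.
exact: jk.
Qed.

Lemma has_cardU (T : Type) (A B : set T) m n :
  A `&` B = set0 -> has_card A m -> has_card B n ->
  has_card (A `|` B) (addnb m n).
Proof.
move=> AB0; case: m n => [m|] [n|] /= Am Bn; last first.
- by rewrite finite_setU => -[].
- by rewrite finite_setU => -[].
- by rewrite finite_setU => -[].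
have /card_set_bijP[f [fA finj fsurj]] := Am.
have /card_set_bijP[g [gB ginj gsurj]] := Bn.
have AB x : A x -> B x -> False.
  by move=> Ax Bx; have : (A `&` B) x by []; rewrite AB0.
apply/card_set_bijP.
(* The elements of [B] are numbered after the [m] elements of [A]. *)
exists (fun x => if pselect (A x) then f x else (m + g x)%N); split.
- move=> x /=; case: pselect => [Ax _|nAx [//|Bx]].
    exact: leq_trans (fA _ Ax) (leq_addr _ _).
  by rewrite ltn_add2l; exact: gB.
- move=> x y /set_mem ABx /set_mem ABy.
  case: pselect => [Ax|nAx]; case: pselect => [Ay|nAy].
  + by apply: finj; exact: mem_set.
  + by move=> /= fg; have := fA _ Ax; rewrite /= fg ltnNge leq_addr.
  + by move=> /= fg; have := fA _ Ay; rewrite /= -fg ltnNge leq_addr.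
  + move=> /= /addnI; apply: ginj; apply: mem_set; first by case: ABx.
    by case: ABy.
- move=> i /= imn; have [im|mi] := ltnP i m.
    have [x Ax xi] := fsurj i im; exists x; first by left.
    by case: pselect.
  have [|x Bx xi] := gsurj (i - m)%N; first by rewrite /= ltn_subLR.
  exists x; first by right.
  by case: pselect => [/AB/(_ Bx)//|_] /=; rewrite xi subnKC.
Qed.

End Cardinality.

(** * Decorated numbers and Dedekind cuts *)

Section DecoratedNumbers.
Variable R : realType.
Local Open Scope ereal_scope.
Implicit Types (a b p q : \bar R) (x y : dnum R).

Lemma ereal_between a b : a < b -> exists p, a < p < b.
Proof.
case: a b => [a||] [b||]// ab.
- exists ((a + b) / 2)%:E; rewrite lte_fin in ab; rewrite !lte_fin.
  by apply/andP; split; lra.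
- by exists (a + 1)%:E; rewrite ltry lte_fin ltrDl ltr01.
- by exists (b - 1)%:E; rewrite ltNyr lte_fin gtrBl ltr01.
- by exists 0; rewrite ltNyr ltry.
Qed.

Lemma lt_dec_extN x p : lt_dec_ext x p = ~~ lt_ext_dec p x.
Proof. by rewrite /lt_dec_ext /lt_ext_dec; case: ltgtP. Qed.

Lemma lt_ext_decW p q x : p <= q -> lt_ext_dec q x -> lt_ext_dec p x.
Proof.
rewrite /lt_ext_dec => pq /orP[qx|/andP[/eqP <- xp]].
  by rewrite (le_lt_trans pq qx).
by move: pq; rewrite le_eqVlt => /orP[->|->//]; rewrite xp orbT.
Qed.

Lemma lt_dec_extW p q x : p <= q -> lt_dec_ext x p -> lt_dec_ext x q.
Proof. by move=> pq; rewrite !lt_dec_extN; apply: contra; exact: lt_ext_decW. Qed.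

Lemma lt_ext_dec_ext p q x : lt_ext_dec p x -> lt_dec_ext x q -> p < q.
Proof.
rewrite lt_dec_extN ltNge => px; apply: contra => qp.
exact: lt_ext_decW px.
Qed.

Lemma le_undecorate p x : lt_ext_dec p x -> p <= undecorate x.
Proof. by rewrite /lt_ext_dec => /orP[/ltW//|/andP[/eqP ->]]. Qed.

Lemma ge_undecorate p x : lt_dec_ext x p -> undecorate x <= p.
Proof. by rewrite /lt_dec_ext => /orP[/ltW//|/andP[/eqP ->]]. Qed.

Lemma dnum_inj x y :
  undecorate x = undecorate y -> is_plus x = is_plus y -> x = y.
Proof. by case: x y => [r|r||] [s|s||]//= [->]. Qed.

(** Either the underlying values differ and a number between them separates, or they coincide and
    the common value separates its two decorations. *)
Lemma dnum_separated x y : x <> y -> exists p,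
  (lt_dec_ext x p /\ lt_ext_dec p y) \/ (lt_dec_ext y p /\ lt_ext_dec p x).
Proof.
move=> xy; have [lt|lt|eq] := ltgtP (undecorate x) (undecorate y).
- have [p /andP[xp py]] := ereal_between lt.
  by exists p; left; rewrite /lt_dec_ext /lt_ext_dec xp py.
- have [p /andP[xp py]] := ereal_between lt.
  by exists p; right; rewrite /lt_dec_ext /lt_ext_dec xp py.
- exists (undecorate x); rewrite /lt_dec_ext /lt_ext_dec eq eqxx !ltxx /=.
  have := @dnum_inj x y eq.
  case: (is_plus x) (is_plus y) => [] [] H; [|by right|by left|];
    by case: xy; apply: H.
Qed.

(* Dedekind cuts of an interval are exactly its decorated numbers. *)
Lemma cut_dnum a b (L : \bar R -> Prop) :
  a < b -> (forall p q, a < p -> p < q -> q < b -> L q -> L p) ->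
  exists x, [/\ lt_ext_dec a x, lt_dec_ext x b &
    forall p, a < p < b -> lt_ext_dec p x <-> L p].
Proof.
move=> ab Llow.
(* Including [a] keeps the supremum at least [a] when [L] holds nowhere in the interval. *)
pose S := [set p | p = a \/ (a < p < b /\ L p)].
pose s := ereal_sup S.
have as_ : a <= s by apply: ereal_sup_ubound; left.
have sb : s <= b.
  by apply: ge_ereal_sup => p [->|[/andP[_ /ltW]]//]; exact: ltW.
have SL p : a < p -> p < s -> L p.
  move=> ap /ereal_sup_gt[q [->|[/andP[aq qb] Lq]] pq].
    by have := lt_trans ap pq; rewrite ltxx.
  exact: Llow Lq.
(* The decoration is plus exactly when the lower part of the cut contains its supremum. The value
   [a] counts as contained and [b] does not, so that [x] falls between them. *)
have [x [xs xP]] : exists x, undecorate x = s /\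
    (is_plus x <-> s < b /\ (s = a \/ L s)).
  move: (s) as_ sb => [t as_ tb| |].
  - have [H|H] := pselect (t%:E < b /\ (t%:E = a \/ L t%:E)).
      by exists (DPlus t).
    by exists (DMinus t).
  - rewrite leye_eq => _ /eqP bE; exists DPInfMinus; split=> //=.
    by rewrite bE ltxx; split=> // -[].
  - rewrite leeNy_eq => /eqP aE _; exists DNInfPlus; split=> //=.
    by rewrite -aE; split=> // _; split; [|left].
have ltE p : lt_ext_dec p x <-> p < s \/ (p = s /\ is_plus x).
  rewrite /lt_ext_dec xs; split=> [/orP[->|/andP[/eqP -> ->]]|].
  - by left.
  - by right.
  - by move=> [->//|[-> ->]]; rewrite eqxx orbT.
exists x; split.
- apply/ltE; move: as_; rewrite le_eqVlt => /orP[/eqP as_|]; [right|by left].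
  by split=> //; apply/xP; rewrite -as_; split=> //; left.
- rewrite lt_dec_extN; apply/negP => /ltE[|[bs /xP[]]].
    by rewrite ltNge sb.
  by rewrite bs ltxx.
- move=> p /andP[ap pb]; split.
    move=> /ltE[|[ps /xP[sb' [sa|]]]]; [exact: SL| |by rewrite ps].
    by move: ap; rewrite ps sa ltxx.
  move=> Lp; apply/ltE.
  have : p <= s by apply: ereal_sup_ubound; right; rewrite ap.
  rewrite le_eqVlt => /orP[/eqP ps|]; [right|by left].
  by split=> //; apply/xP; rewrite -ps; split=> //; right.
Qed.

End DecoratedNumbers.

(** * Construction of the decorated multiset from a finite r-measure *)

Section DiagramExistence.
Variables (R : realType) (D : set (\bar R * \bar R)) (mu : rect R -> natbar).
Hypothesis mu_finite : finite_r_measure D mu.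
Local Open Scope ereal_scope.
Implicit Types (a b c d p q : \bar R) (z w : dpoint R).

Let RD a b c d := Rect D (MkRect a b c d).
Let nu a b c d := odflt 0%N (mu (MkRect a b c d)).

Lemma mu_Some r : Rect D r -> mu r = Some (odflt 0%N (mu r)).
Proof. by move=> /mu_finite.2; case: (mu r). Qed.

Let muE a b c d : RD a b c d -> mu (MkRect a b c d) = Some (nu a b c d).
Proof. exact: mu_Some. Qed.

Let RD_sub a b c d a' b' c' d' : RD a b c d ->
  a <= a' -> a' < b' -> b' <= b -> c <= c' -> c' < d' -> d' <= d ->
  RD a' b' c' d'.
Proof.
move=> [_ rD] aa' ab bb' cc' cd dd'; split; first by [].
move=> z [/= /andP[az zb] /andP[cz zd]]; apply: rD; split=> /=.
  by rewrite (le_trans aa')// (le_trans zb).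
by rewrite (le_trans cc')// (le_trans zd).
Qed.

Let nu_x a b c d p : RD a b c d -> a < p < b ->
  nu a b c d = (nu a p c d + nu p b c d)%N.
Proof.
move=> abcd /[dup] apb /andP[ap pb]; have [[/= ab cd] _] := abcd.
(* [r_measure] splits in both coordinates at once, so a cut of the other side has to be supplied. *)
have [q cqd] := ereal_between cd.
have [+ _] := mu_finite.1 _ _ _ _ _ _ abcd apb cqd.
have apcd : RD a p c d by apply: (RD_sub abcd) => //; exact: ltW.
have pbcd : RD p b c d by apply: (RD_sub abcd) => //; exact: ltW.
by rewrite (muE abcd) (muE apcd) (muE pbcd) => -[].
Qed.

Let nu_y a b c d q : RD a b c d -> c < q < d ->
  nu a b c d = (nu a b c q + nu a b q d)%N.
Proof.
move=> abcd /[dup] cqd /andP[cq qd]; have [[/= ab cd] _] := abcd.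
have [p apb] := ereal_between ab.
have [_] := mu_finite.1 _ _ _ _ _ _ abcd apb cqd.
have apcd : RD a b c q by apply: (RD_sub abcd) => //; exact: ltW.
have pbcd : RD a b q d by apply: (RD_sub abcd) => //; exact: ltW.
by rewrite (muE abcd) (muE apcd) (muE pbcd) => -[].
Qed.

Let nu_mono a b c d a' b' c' d' : RD a b c d ->
  a <= a' -> a' < b' -> b' <= b -> c <= c' -> c' < d' -> d' <= d ->
  (nu a' b' c' d' <= nu a b c d)%N.
Proof.
move=> abcd aa' ab bb' cc' cd dd'.
have [[/= ab0 cd0] _] := abcd.
have a'b : a' < b := lt_le_trans ab bb'.
have c'd : c' < d := lt_le_trans cd dd'.
have le1 : (nu a' b c d <= nu a b c d)%N.
  move: (aa'); rewrite le_eqVlt => /orP[/eqP -> //|lt].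
  by rewrite (@nu_x a b c d a')// ?lt ?a'b// leq_addl.
have r1 : RD a' b c d by exact: (RD_sub abcd).
have le2 : (nu a' b' c d <= nu a' b c d)%N.
  move: (bb'); rewrite le_eqVlt => /orP[/eqP -> //|lt].
  by rewrite (@nu_x a' b c d b')// ?lt ?ab// leq_addr.
have r2 : RD a' b' c d by exact: (RD_sub abcd).
have le3 : (nu a' b' c' d <= nu a' b' c d)%N.
  move: (cc'); rewrite le_eqVlt => /orP[/eqP -> //|lt].
  by rewrite (@nu_y a' b' c d c')// ?lt ?c'd// leq_addl.
have r3 : RD a' b' c' d by exact: (RD_sub abcd).
have le4 : (nu a' b' c' d' <= nu a' b' c' d)%N.
  move: (dd'); rewrite le_eqVlt => /orP[/eqP -> //|lt].
  by rewrite (@nu_y a' b' c' d d')// ?lt ?cd// leq_addr.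
exact: leq_trans le4 (leq_trans le3 (leq_trans le2 le1)).
Qed.

Let around z n := exists r, [/\ Rect D r, dpoint_in z r & mu r = Some n].

(** The multiplicity of [z] is the least measure of a rectangle of [Rect D] to which [z] belongs,
    and 0 if there is none. *)
Let mult : multiset (dpoint R) := fun z =>
  if pselect (exists n, `[< around z n >]) is left h then Some (ex_minn h)
  else Some 0%N.

Let mult_gt0 z i : copies mult (z, i) -> exists2 r, Rect D r & dpoint_in z r.
Proof.
rewrite /copies /mult /=; case: pselect => // -[n /asboolP[r [rD zr _]]] _.
by exists r.
Qed.

Let multP a b c d z : RD a b c d -> dpoint_in z (MkRect a b c d) ->
  exists k, [/\ mult z = Some k, (k <= nu a b c d)%N & around z k].
Proof.
move=> abcd zr; rewrite /mult; case: pselect => [h|[]]; last first.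
  exists (nu a b c d); apply/asboolP; exists (MkRect a b c d).
  by split=> //; exact: muE.
exists (ex_minn h); split=> //; case: ex_minnP => m /asboolP// _; apply.
by apply/asboolP; exists (MkRect a b c d); split=> //; exact: muE.
Qed.

Let mult0 a b c d z : RD a b c d -> dpoint_in z (MkRect a b c d) ->
  nu a b c d = 0%N -> mult z = Some 0%N.
Proof.
move=> abcd zr nu0; have [k [-> + _]] := multP abcd zr.
by rewrite nu0 leqn0 => /eqP ->.
Qed.

Let points a b c d := copies mult `&` [set u | dpoint_in u.1 (MkRect a b c d)].

(** A decorated number is always strictly on one side of [p], so no point is lost or counted twice
    at the cut. *)
Let points_x a b c d p : a < p < b ->
  points a b c d = points a p c d `|` points p b c d /\
  points a p c d `&` points p b c d = set0.
Proof.
move=> /andP[ap pb]; split; apply/seteqP; split=> [[[x y] i]|[[x y] i]] //=.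
- move=> [cp [/= ax xb cy yd]].
  have [px|] := boolP (lt_ext_dec p x); first by right.
  by rewrite -lt_dec_extN => xp; left.
- move=> [[cp [/= ax xb cy yd]]|[cp [/= ax xb cy yd]]]; split=> //; split=> //=.
    exact: lt_dec_extW (ltW pb) xb.
  exact: lt_ext_decW (ltW ap) ax.
- by move=> [[_ [/= _ + _ _]] [_ [/= + _ _ _]]]; rewrite lt_dec_extN => /negP.
Qed.

Let points_y a b c d q : c < q < d ->
  points a b c d = points a b c q `|` points a b q d /\
  points a b c q `&` points a b q d = set0.
Proof.
move=> /andP[cq qd]; split; apply/seteqP; split=> [[[x y] i]|[[x y] i]] //=.
- move=> [cp [/= ax xb cy yd]].
  have [qy|] := boolP (lt_ext_dec q y); first by right.
  by rewrite -lt_dec_extN => yq; left.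
- move=> [[cp [/= ax xb cy yd]]|[cp [/= ax xb cy yd]]]; split=> //; split=> //=.
    exact: lt_dec_extW (ltW qd) yd.
  exact: lt_ext_decW (ltW cq) cy.
- by move=> [[_ [/= _ _ _ +]] [_ [/= _ _ + _]]]; rewrite lt_dec_extN => /negP.
Qed.

(* When no cut splits mu, the sides carrying no mass define a Dedekind cut in
   each coordinate, hence the decorated point carrying all of it. *)
Let concentrated a b c d : RD a b c d -> (0 < nu a b c d)%N ->
  (forall p, a < p < b -> nu a p c d = 0%N \/ nu p b c d = 0%N) ->
  (forall q, c < q < d -> nu a b c q = 0%N \/ nu a b q d = 0%N) ->
  exists z, [/\ dpoint_in z (MkRect a b c d), mult z = Some (nu a b c d) &
    forall w, dpoint_in w (MkRect a b c d) -> w <> z -> mult w = Some 0%N].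
Proof.
move=> abcd n0 splitx splity; have [[/= ab cd] _] := abcd.
(* The cut consists of those [p] with no mass to their left; it is downward closed by
   monotonicity. *)
have [|x [ax xb xP]] := @cut_dnum R a b (fun p => nu a p c d = 0%N) ab.
  move=> p q ap pq qb nu0; apply/eqP; rewrite -leqn0 -nu0; apply: nu_mono => //.
    by apply: (RD_sub abcd) => //; [exact: lt_trans pq|exact: ltW].
  exact: ltW.
have [|y [cy yd yP]] := @cut_dnum R c d (fun q => nu a b c q = 0%N) cd.
  move=> p q ap pq qb nu0; apply/eqP; rewrite -leqn0 -nu0; apply: nu_mono => //.
    by apply: (RD_sub abcd) => //; [exact: lt_trans pq|exact: ltW].
  exact: ltW.
have x0 p : a < p -> lt_ext_dec p x -> nu a p c d = 0%N.
  by move=> ap px; apply/xP => //; rewrite ap (lt_ext_dec_ext px xb).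
have y0 q : c < q -> lt_ext_dec q y -> nu a b c q = 0%N.
  by move=> cq qy; apply/yP => //; rewrite cq (lt_ext_dec_ext qy yd).
have x1 p : p < b -> lt_dec_ext x p -> nu p b c d = 0%N.
  move=> pb xp; have apb : a < p < b by rewrite pb (lt_ext_dec_ext ax xp).
  have [/xP|//] := splitx p apb.
  by move=> /(_ apb) px; move: xp; rewrite lt_dec_extN px.
have y1 q : q < d -> lt_dec_ext y q -> nu a b q d = 0%N.
  move=> qd yq; have cqd : c < q < d by rewrite qd (lt_ext_dec_ext cy yq).
  have [/yP|//] := splity q cqd.
  by move=> /(_ cqd) qy; move: yq; rewrite lt_dec_extN qy.
(* Every part trimmed off lies on a side of [x] or of [y] that carries no mass. *)
have shrink a' b' c' d' : a <= a' -> b' <= b -> c <= c' -> d' <= d ->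
    dpoint_in (x, y) (MkRect a' b' c' d') -> nu a' b' c' d' = nu a b c d.
  move=> aa' bb' cc' dd' [/= a'x xb' c'y yd'].
  have a'b' := lt_ext_dec_ext a'x xb'; have c'd' := lt_ext_dec_ext c'y yd'.
  have a'b := lt_ext_dec_ext a'x xb; have c'd := lt_ext_dec_ext c'y yd.
  have -> : nu a b c d = nu a' b c d.
    move: aa'; rewrite le_eqVlt => /orP[/eqP -> //|lt].
    by rewrite (@nu_x a b c d a')// ?lt ?a'b// x0.
  have r1 : RD a' b c d by exact: (RD_sub abcd).
  have -> : nu a' b c d = nu a' b' c d.
    move: (bb'); rewrite le_eqVlt => /orP[/eqP -> //|lt].
    by rewrite (@nu_x a' b c d b')// ?lt ?a'b'// x1// addn0.
  have r2 : RD a' b' c d by exact: (RD_sub abcd).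
  have -> : nu a' b' c d = nu a' b' c' d.
    move: (cc'); rewrite le_eqVlt => /orP[/eqP -> //|lt].
    rewrite (@nu_y a' b' c d c')// ?lt ?c'd//.
    suff -> : nu a' b' c c' = 0%N by [].
    apply/eqP; rewrite -leqn0 -(y0 c' lt c'y); apply: nu_mono => //.
    by apply: (RD_sub abcd) => //; exact: ltW.
  have r3 : RD a' b' c' d by exact: (RD_sub abcd).
  move: (dd'); rewrite le_eqVlt => /orP[/eqP -> //|lt].
  rewrite [RHS](@nu_y a' b' c' d d')// ?lt ?c'd'//.
  suff -> : nu a' b' d' d = 0%N by rewrite addn0.
  apply/eqP; rewrite -leqn0 -(y1 d' lt yd'); apply: nu_mono => //.
  apply: (RD_sub abcd) => //; apply: ltW.
  exact: lt_ext_dec_ext cy yd'.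
have zr : dpoint_in (x, y) (MkRect a b c d) by split.
exists (x, y); split=> //.
- have [k [-> kle [[a' b' c' d'] [r'D [/= a'x xb' c'y yd'] muk]]]] := multP abcd zr.
  congr Some; apply/eqP; rewrite eqn_leq kle /=.
  have lt_extI p q u : lt_ext_dec p u -> lt_ext_dec q u -> lt_ext_dec (maxe p q) u.
    by rewrite /maxe; case: ifP.
  have lt_decI p q u : lt_dec_ext u p -> lt_dec_ext u q -> lt_dec_ext u (mine p q).
    by rewrite /mine; case: ifP.
  have a''x := lt_extI _ _ _ ax a'x; have xb'' := lt_decI _ _ _ xb xb'.
  have c''y := lt_extI _ _ _ cy c'y; have yd'' := lt_decI _ _ _ yd yd'.
  (* The rectangle attaining the minimum is intersected with the given one: the intersection still
     contains the point, so it carries the full mass, and monotonicity bounds this mass by [k]. *)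
  rewrite -(shrink (maxe a a') (mine b b') (maxe c c') (mine d d'));
    rewrite ?le_max ?ge_min ?lexx//.
  have -> : k = nu a' b' c' d' by rewrite /nu muk.
  apply: nu_mono => //; rewrite ?le_max ?ge_min ?lexx ?orbT//.
    exact: lt_ext_dec_ext a''x xb''.
  exact: lt_ext_dec_ext c''y yd''.
- move=> [u v] [/= au ub cv vd] wz.
  (* A line separates any other point from the concentrated one, and the side holding that other
     point has measure 0. *)
  have [ux|/dnum_separated[p]] := pselect (u = x); last first.
    move=> [[up px]|[xp pu]].
      have ap := lt_ext_dec_ext au up.
      apply: (@mult0 a p c d) (x0 _ ap px) => //.
      by apply: (RD_sub abcd) => //; exact/ltW/(lt_ext_dec_ext px xb).
    have pb := lt_ext_dec_ext pu ub.
    apply: (@mult0 p b c d) (x1 _ pb xp) => //.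
    by apply: (RD_sub abcd) => //; exact/ltW/(lt_ext_dec_ext ax xp).
  have [vy|/dnum_separated[q]] := pselect (v = y); first by case: wz; rewrite ux vy.
  move=> [[vq qy]|[yq qv]].
    have cq := lt_ext_dec_ext cv vq.
    apply: (@mult0 a b c q) (y0 _ cq qy) => //.
    by apply: (RD_sub abcd) => //; exact/ltW/(lt_ext_dec_ext qy yd).
  have qd := lt_ext_dec_ext qv vd.
  apply: (@mult0 a b q d) (y1 _ qd yq) => //.
  by apply: (RD_sub abcd) => //; exact/ltW/(lt_ext_dec_ext cy yq).
Qed.

(** Strong induction on the mass: a cut into two parts of nonzero mass lowers it in both; if no such
    cut exists, [concentrated] places all of it at one decorated point. *)
Let mult_card n a b c d : RD a b c d -> nu a b c d = n ->
  has_card (points a b c d) (Some n).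
Proof.
elim/ltn_ind: n a b c d => n IH a b c d abcd nun.
have [[/= ab cd] _] := abcd.
have [n0|n0] := posnP n.
  have -> : points a b c d = set0.
    apply/seteqP; split=> // -[z i] [+ /= zr]; rewrite /copies /=.
    by rewrite (mult0 abcd zr) ?nun ?n0.
  by rewrite n0 /= II0.
have [[p apb [l0 r0]]|nsplitx] := pselect (exists2 p, a < p < b &
    nu a p c d <> 0%N /\ nu p b c d <> 0%N).
  have /andP[ap pb] := apb.
  have nE := nu_x abcd apb; rewrite nun in nE.
  have [-> dis] := points_x c d apb; rewrite nE.
  apply: (@has_cardU _ _ _ (Some _) (Some _)) => //; apply: IH => //.
  - by rewrite nE -[ltnLHS]addn0 ltn_add2l lt0n; apply/eqP.
  - by apply: (RD_sub abcd) => //; exact: ltW.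
  - by rewrite nE -[ltnLHS]add0n ltn_add2r lt0n; apply/eqP.
  - by apply: (RD_sub abcd) => //; exact: ltW.
have [[q cqd [l0 r0]]|nsplity] := pselect (exists2 q, c < q < d &
    nu a b c q <> 0%N /\ nu a b q d <> 0%N).
  have /andP[cq qd] := cqd.
  have nE := nu_y abcd cqd; rewrite nun in nE.
  have [-> dis] := points_y a b cqd; rewrite nE.
  apply: (@has_cardU _ _ _ (Some _) (Some _)) => //; apply: IH => //.
  - by rewrite nE -[ltnLHS]addn0 ltn_add2l lt0n; apply/eqP.
  - by apply: (RD_sub abcd) => //; exact: ltW.
  - by rewrite nE -[ltnLHS]add0n ltn_add2r lt0n; apply/eqP.
  - by apply: (RD_sub abcd) => //; exact: ltW.
have [||| z [zr mz m0]] := concentrated abcd; first by rewrite nun.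
- move=> p apb; apply: contrapT => /not_orP[l0 r0]; apply: nsplitx.
  by exists p.
- move=> q cqd; apply: contrapT => /not_orP[l0 r0]; apply: nsplity.
  by exists q.
have -> : points a b c d = (pair z) @` `I_n.
  apply/seteqP; split=> [[w i] [/= + wr]|_ [i /= lt <-]]; last first.
    by split=> //; rewrite /copies /= mz nun.
  rewrite /copies /=; have [-> |wz] := pselect (w = z).
    by rewrite mz nun => /= ?; exists i.
  by rewrite m0.
by apply: inj_card_eq => i j _ _ [].
Qed.

Lemma is_Dgm_Dgm : is_Dgm D mu (Dgm D mu).
Proof.
apply: (@xgetPex _ (fun=> Some 0%N) [set m | is_Dgm D mu m]).
exists mult; split=> [[z i] /mult_gt0//|[a b c d] abcd].
by rewrite (muE abcd); exact: mult_card.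
Qed.

End DiagramExistence.

(** * Counting undecorated points *)

Section UndecoratedCount.
Variables (R : realType).
Local Open Scope card_scope.

Lemma has_card_copies (T : Type) (m : multiset T) x :
  has_card [set c | copies m c /\ c.1 = x] (m x).
Proof.
have -> : [set c | copies m c /\ c.1 = x] =
    pair x @` [set i | lenb (Some i.+1) (m x)].
  apply/seteqP; split=> [[y i] [/= + yx]|_ [i ix <-]//].
  by rewrite /copies /= yx => ix; exists i.
have : pair x @` [set i | lenb (Some i.+1) (m x)]
    #= [set i | lenb (Some i.+1) (m x)] by apply: inj_card_eq => i j _ _ [].
case: (m x) => [k|] /=; first exact.
move=> /eq_finite_set -> fin; apply: infinite_nat.
by apply: sub_finite_set fin.
Qed.

(** Used once per coordinate, this matches the iterated sum in [dgm] with the decorated points lying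
    over one undecorated point. *)
Lemma has_card_decorations (T : Type) (F : dnum R -> natbar)
    (S : dnum R -> set T) (p : \bar R) :
  (forall x, has_card (S x) (F x)) ->
  (forall x y t, S x t -> S y t -> x = y) ->
  has_card [set t | exists2 x, undecorate x = p & S x t]
    (\big[addnb/Some 0%N]_(x <- decorations p) F x).
Proof.
have has_card0 : has_card (set0 : set T) (Some 0%N) by rewrite /= II0.
move=> SF disj; case: p => [p||]; rewrite ?big_cons big_nil.
- have -> : [set t | exists2 x, undecorate x = p%:E & S x t] =
      S (DMinus p) `|` (S (DPlus p) `|` set0).
    apply/seteqP; split=> [t [[q|q||]//= [->]]|t [|[]//]]; first by left.
    + by right; left.
    + by exists (DMinus p).
    + by exists (DPlus p).
  apply: has_cardU => //; last by apply: has_cardU => //; rewrite setI0.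
  by rewrite setU0; apply/seteqP; split=> // t [m p'] /=; have := disj _ _ _ m p'.
- have -> : [set t | exists2 x, undecorate x = +oo%E & S x t] =
      S DPInfMinus `|` set0.
    by apply/seteqP; split=> [t [[q|q||]//=]|t []//]; [left|exists DPInfMinus].
  by apply: has_cardU => //; rewrite setI0.
- have -> : [set t | exists2 x, undecorate x = -oo%E & S x t] =
      S DNInfPlus `|` set0.
    by apply/seteqP; split=> [t [[q|q||]//=]|t []//]; [left|exists DNInfPlus].
  by apply: has_cardU => //; rewrite setI0.
Qed.

Definition undec2 (z : dpoint R) : \bar R * \bar R :=
  (undecorate z.1, undecorate z.2).

Lemma dpoint_in_rect_set (z : dpoint R) r : dpoint_in z r -> rect_set r (undec2 z).
Proof.
by move=> [az zb cz zd]; split; rewrite /= ?(le_undecorate az)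
  ?(ge_undecorate zb) ?(le_undecorate cz) ?(ge_undecorate zd).
Qed.

Lemma has_card_dgm_fiber (D : set (\bar R * \bar R)) mu z :
  open D -> D z ->
  has_card [set c | copies (Dgm D mu) c /\ undec2 c.1 = z] (dgm D mu z).
Proof.
move=> Dopen Dz; rewrite /dgm asboolT; last exact: open_nbhs_nbhs.
pose S x y := [set c | copies (Dgm D mu) c /\ c.1 = (x, y)].
have -> : [set c | copies (Dgm D mu) c /\ undec2 c.1 = z] =
    [set c | exists2 x, undecorate x = z.1 &
      [set c | exists2 y, undecorate y = z.2 & S x y c] c].
  apply/seteqP; split=> [[[x y] i] [/= xyi <-]|[[x y] i]] /=.
    by exists x => //; exists y.
  move=> [x' xz [y' yz [cp [/= xx' yy']]]]; split=> //.
  by rewrite /undec2 /= xx' yy' xz yz -surjective_pairing.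
apply: has_card_decorations => [x|x x' c [y _ [_ cE]] [y' _ [_]]]; last first.
  by rewrite cE => -[].
apply: has_card_decorations => [y|y y' c [_ cE] [_]]; last by rewrite cE => -[].
exact: has_card_copies.
Qed.

(** Bijections between the fibres over each point of [D] are chosen and glued. *)
Lemma card_dgm (D E : set (\bar R * \bar R)) mu : open D -> E `<=` D ->
  (forall z, D z -> finite_set [set c | copies (Dgm D mu) c /\ undec2 c.1 = z]) ->
  copies (Dgm D mu) `&` [set c | E (undec2 c.1)]
    #= copies (dgm D mu) `&` [set c | E c.1].
Proof.
move=> Dopen ED fin.
have [h hP] : {h : \bar R * \bar R -> dpoint R * nat -> (\bar R * \bar R) * nat &
    forall z, D z -> set_bij [set c | copies (Dgm D mu) c /\ undec2 c.1 = z]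
      [set c | copies (dgm D mu) c /\ c.1 = z] (h z)}.
  apply: (@choice _ _ (fun z h => D z ->
    set_bij [set c | copies (Dgm D mu) c /\ undec2 c.1 = z]
      [set c | copies (dgm D mu) c /\ c.1 = z] h)) => z.
  have [Dz|nDz] := pselect (D z); last by exists (fun=> point).
  have := has_card_dgm_fiber mu Dopen Dz; have := has_card_copies (dgm D mu) z.
  (* [has_card] at [None] only says infinite and would yield no bijection; finiteness of the fibre
     rules this case out. *)
  case: (dgm D mu z) => [k|]; last by move=> _ /(_ (fin z Dz)).
  by move=> /has_card_eq/[apply]/card_esym/card_set_bijP[h hP]; exists h.
apply/card_set_bijP; exists (fun c => h (undec2 c.1) c); split.
- move=> c [cp Ec]; have [hfun _ _] := hP _ (ED _ Ec).
  by have [hc /= hz] := hfun c (conj cp erefl); split=> //=; rewrite hz.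
- move=> c c' /set_mem[cp Ec] /set_mem[cp' Ec'] hcc.
  have [hfun hinj _] := hP _ (ED _ Ec).
  have [hfun' _ _] := hP _ (ED _ Ec').
  have [_ hz] := hfun c (conj cp erefl); have [_ hz'] := hfun' c' (conj cp' erefl).
  have uE : undec2 c.1 = undec2 c'.1 by rewrite -[LHS]hz -[RHS]hz' hcc.
  by apply: hinj; rewrite ?[in RHS]uE//; apply: mem_set; split.
- move=> c [cp /= Ec]; have [_ _ hsurj] := hP _ (ED _ Ec).
  have [c' [cp' cz] hc'] := hsurj c (conj cp erefl).
  by exists c'; rewrite ?cz//; split=> //=; rewrite cz.
Qed.

End UndecoratedCount.

(** * Rectangles shrinking to closed balls *)

Section Boxes.
Variable R : realType.
Local Open Scope ereal_scope.
Implicit Types (p u : \bar R) (z w : \bar R * \bar R) (r s e : R) (n : nat).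

(** An ultrafilter converges to the supremum of those [y] whose upper ray belongs to it. *)
Lemma compact_ereal : compact [set: \bar R].
Proof.
rewrite compact_ultra => F FU _.
pose s := ereal_sup [set y | F [set z | y <= z]].
have Fgt y : y < s -> F [set z | y < z].
  move=> /ereal_sup_gt[y' Fy' yy']; apply: filterS Fy' => z.
  exact: lt_le_trans.
have Flt y : s < y -> F [set z | z < y].
  move=> sy; have [Fy|] := in_ultra_setVsetC [set z | y <= z] FU.
    have : y <= s by apply: ereal_sup_ubound; exact: Fy.
    by rewrite leNgt sy.
  by apply: filterS => z /= /negP; rewrite -ltNge.
exists s; split=> // A; rewrite itv_nbhsE => -[[ [[]/= x|[]] [[]/= y|[]] ]][]// _.
- rewrite in_itv/= => /andP[/Fgt xs /Flt sy] xyA.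
  apply: filterS (filterI xs sy) => z [xz zy].
  by apply: xyA; rewrite /= in_itv/= xz.
- rewrite in_itv/= andbT => /Fgt xs xA.
  by apply: filterS xs => z xz; apply: xA; rewrite /= in_itv/= andbT.
- rewrite in_itv/= => /Flt sy yA.
  by apply: filterS sy => z zy; apply: yA; rewrite /= in_itv.
- by move=> _; rewrite set_itvE subTset => ->; exact: filterT.
Qed.

(** At [+oo] the side [n - r] tends to [+oo], leaving only that point in the limit. Subtracting [r]
    there too makes thickening by [s] replace [r] by [r + s] in every case; [hi] is the mirror
    image. *)
Definition lo n r p : \bar R :=
  match p with
  | p%:E => (p - r - n.+1%:R^-1)%:E
  | +oo => (n%:R - r)%:E
  | -oo => -oo
  end.

Definition hi n r p : \bar R :=
  match p with
  | p%:E => (p + r + n.+1%:R^-1)%:E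
  | +oo => +oo
  | -oo => (r - n%:R)%:E
  end.

(* A decreasing sequence of rectangles with intersection [dball z r]. *)
Definition cbox n r z : rect R :=
  MkRect (lo n r z.1) (hi n r z.1) (lo n r z.2) (hi n r z.2).

Lemma thicken_cbox n r s z : thicken s (cbox n r z) = cbox n (r + s) z.
Proof.
have loE p : lo n r p - s%:E = lo n (r + s) p.
  by case: p => [p||]//=; rewrite -EFinB; congr EFin; ring.
have hiE p : hi n r p + s%:E = hi n (r + s) p.
  by case: p => [p||]//=; rewrite -EFinD; congr EFin; ring.
by rewrite /thicken /cbox /= !loE !hiE.
Qed.

Lemma lo_lt_hi n r p : (0 <= r)%R -> lo n r p < hi n r p.
Proof.
move=> r0; case: p => [p||]/=; rewrite ?ltry ?ltNyr// lte_fin.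
have : (0 < n.+1%:R^-1 :> R)%R by rewrite invr_gt0.
by move: n.+1%:R^-1%R => e; lra.
Qed.

Lemma proper_cbox n r z : (0 <= r)%R -> proper_rect (cbox n r z).
Proof. by move=> r0; split; exact: lo_lt_hi. Qed.

Lemma le_lo m n r s p : (m <= n)%N -> (r <= s)%R -> lo m s p <= lo n r p.
Proof.
move=> mn rs; case: p => [p||]//=; rewrite lee_fin.
  have : (n.+1%:R^-1 <= m.+1%:R^-1 :> R)%R by rewrite lef_pV2 ?posrE// ler_nat.
  by move: n.+1%:R^-1%R m.+1%:R^-1%R => e f; lra.
have : (m%:R <= n%:R :> R)%R by rewrite ler_nat.
by lra.
Qed.

Lemma le_hi m n r s p : (m <= n)%N -> (r <= s)%R -> hi n r p <= hi m s p.
Proof.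
move=> mn rs; case: p => [p||]//=; rewrite lee_fin.
  have : (n.+1%:R^-1 <= m.+1%:R^-1 :> R)%R by rewrite lef_pV2 ?posrE// ler_nat.
  by move: n.+1%:R^-1%R m.+1%:R^-1%R => e f; lra.
have : (m%:R <= n%:R :> R)%R by rewrite ler_nat.
by lra.
Qed.

Lemma subset_cbox m n r s z : (m <= n)%N -> (r <= s)%R ->
  rect_set (cbox n r z) `<=` rect_set (cbox m s z).
Proof.
move=> mn rs w [/= /andP[l1 h1] /andP[l2 h2]]; split=> /=.
  by rewrite (le_trans (le_lo _ mn rs) l1) (le_trans h1 (le_hi _ mn rs)).
by rewrite (le_trans (le_lo _ mn rs) l2) (le_trans h2 (le_hi _ mn rs)).
Qed.

Lemma dpoint_in_subset_cbox m n r z x : (m <= n)%N ->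
  dpoint_in x (cbox n r z) -> dpoint_in x (cbox m r z).
Proof.
move=> mn [/= l1 h1 l2 h2]; split=> /=.
- exact: lt_ext_decW (le_lo _ mn _) l1.
- exact: lt_dec_extW (le_hi _ mn _) h1.
- exact: lt_ext_decW (le_lo _ mn _) l2.
- exact: lt_dec_extW (le_hi _ mn _) h2.
Qed.

(** The positive margin makes the inequalities at finite coordinates strict, so decorations there do
    not matter; at infinity the only decoration points inwards. *)
Lemma cbox_dpoint n r z x : dball z r (undec2 x) -> dpoint_in x (cbox n r z).
Proof.
have e0 : (0 < n.+1%:R^-1 :> R)%R by rewrite invr_gt0.
have lo_lt p y : dcoord p (undecorate y) <= r%:E -> lt_ext_dec (lo n r p) y.
  case: p y => [p||] [y|y||] //=; rewrite /lt_ext_dec /= ?ltry ?ltNyr// lte_fin.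
    by rewrite dcoord_le_fin ler_norml => /andP[]; move: n.+1%:R^-1%R e0 => e; lra.
  by rewrite dcoord_le_fin ler_norml => /andP[]; move: n.+1%:R^-1%R e0 => e; lra.
have lt_hi p y : dcoord p (undecorate y) <= r%:E -> lt_dec_ext y (hi n r p).
  case: p y => [p||] [y|y||] //=; rewrite /lt_dec_ext /= ?ltry ?ltNyr// lte_fin.
    by rewrite dcoord_le_fin ler_norml => /andP[]; move: n.+1%:R^-1%R e0 => e; lra.
  by rewrite dcoord_le_fin ler_norml => /andP[]; move: n.+1%:R^-1%R e0 => e; lra.
rewrite /dball /= dinfty_le /= => /andP[d1 d2].
by split; [exact: lo_lt|exact: lt_hi|exact: lo_lt|exact: lt_hi].
Qed.

Lemma dball_sub_cbox n e z : (e <= n.+1%:R^-1)%R ->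
  dball z e `<=` rect_set (cbox n 0 z).
Proof.
have e0 : (0 < n.+1%:R^-1 :> R)%R by rewrite invr_gt0.
move=> en; have in_lohi p u : dcoord p u <= e%:E -> lo n 0 p <= u <= hi n 0 p.
  case: p u => [p||] [u||] //=; rewrite ?leey ?leNye ?lee_fin//.
  rewrite dcoord_le_fin ler_norml => /andP[+ +]; move: n.+1%:R^-1%R en e0.
  by move=> f *; apply/andP; split; lra.
move=> w; rewrite /dball /= dinfty_le => /andP[d1 d2].
by split; exact: in_lohi.
Qed.

Lemma near_cbox_notin r z w : (0 <= r)%R -> ~ dball z r w ->
  \forall n \near \oo, ~ rect_set (cbox n r z) w.
Proof.
move=> r0; have out p u : ~ dcoord p u <= r%:E ->
    \forall n \near \oo, ~ lo n r p <= u <= hi n r p.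
  case: p u => [p||] [u||] //=; try by move=> _; near=> n;
    rewrite /= ?leye_eq ?leeNy_eq ?andbF.
  - rewrite dcoord_le_fin => /negP; rewrite -ltNge => rpu.
    have pos : (0 < `|p - u| - r)%R by rewrite subr_gt0.
    near=> n; rewrite !lee_fin => /andP[l h].
    have : (n.+1%:R^-1 < `|p - u| - r)%R.
      by near: n; exact: near_infty_natSinv_lt (PosNum pos).
    apply/negP; rewrite -leNgt lerBlDr ler_norml.
    move: n.+1%:R^-1%R l h => e l h.
    by apply/andP; split; lra.
  - move=> _; near=> n; rewrite leey andbT lee_fin; apply/negP.
    rewrite -ltNge ltrBrDr; near: n; exact: nbhs_infty_gtr.
  - move=> _; near=> n; rewrite leNye /= lee_fin; apply/negP.
    rewrite -ltNge ltrBlDl -ltrBlDr; near: n; exact: nbhs_infty_gtr.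
rewrite /dball /= dinfty_le => /negP; rewrite negb_and => /orP[] /negP /out.
  by apply: filterS => n nw [].
by apply: filterS => n nw [].
Unshelve. all: by end_near. Qed.

Lemma closed_rect_set (b : rect R) : closed (rect_set b).
Proof.
have cl (a c : \bar R) : closed [set x | a <= x <= c].
  have -> : [set x | a <= x <= c] = [set x | a <= x] `&` [set x | x <= c].
    by apply/seteqP; split=> x /= => [/andP[]|[-> ->]].
  by apply: closedI; [exact: closed_ereal_le_ereal|exact: closed_ereal_ge_ereal].
apply: closedI.
  by apply: (@preimage_closed _ _ fst _ _ (cl _ _)) => z _; exact: cvg_fst.
by apply: (@preimage_closed _ _ snd _ _ (cl _ _)) => z _; exact: cvg_snd.
Qed.

(** The part of the first box outside [D] is compact, and each of its points has a neighbourhood,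
    the complement of some closed box, that all later boxes miss. Compactness gives one index for
    all points. *)
Lemma near_cbox_subset (D : set (\bar R * \bar R)) r z : open D -> (0 <= r)%R ->
  dball z r `<=` D -> \forall n \near \oo, rect_set (cbox n r z) `<=` D.
Proof.
move=> Dopen r0 zD.
have Kcpt : compact (rect_set (cbox 0 r z) `&` ~` D).
  apply: (@subclosed_compact _ _ ([set: \bar R] `*` [set: \bar R])) => //.
    by apply: closedI; [exact: closed_rect_set|exact: open_closedC].
  by apply: compact_setX; exact: compact_ereal.
have : \forall n \near \oo, rect_set (cbox 0 r z) `&` ~` D `<=`
    [set w | ~ rect_set (cbox n r z) w].
  apply: ((compact_near_coveringP _).1 Kcpt) => w [_ nDw].
  have /(near_cbox_notin r0)[m _ mP] : ~ dball z r w by move=> /zD.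
  exists (~` rect_set (cbox m r z), [set n | (m <= n)%N]).
    split; last by exists m.
    apply: open_nbhs_nbhs; split; first exact/closed_openC/closed_rect_set.
    by apply: mP => /=.
  by move=> [w' n] [/= w'm mn] /(subset_cbox mn (lexx r)).
apply: filterS => n nK w nw; apply: contrapT => nDw.
by apply: (nK w _ nw); split=> //; exact: subset_cbox nw.
Qed.

Lemma near_dball_subset (D : set (\bar R * \bar R)) z : open D -> D z ->
  \forall e \near 0^'+, dball z e `<=` D.
Proof.
move=> Dopen Dz.
have [|n nD] := filter_ex (near_cbox_subset (z := z) Dopen (lexx 0%R) _).
  by rewrite dball0 => _ ->.
near=> e; apply: subset_trans nD; apply: dball_sub_cbox.
by near: e; apply: nbhs_right_le; rewrite invr_gt0.
Unshelve. all: by end_near. Qed.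

End Boxes.

(** * From the box inequality to the ball inequality *)

Section BallInequality.
Variables (R : realType) (D : set (\bar R * \bar R)).
Hypothesis Dopen : open D.
Local Open Scope card_scope.

Lemma finite_Dgm_dball mu z r : finite_r_measure D mu -> 0 <= r ->
  dball z r `<=` D ->
  finite_set (copies (Dgm D mu) `&` [set c | dball z r (undec2 c.1)]).
Proof.
move=> mufin r0 zD.
have [n nD] := filter_ex (near_cbox_subset Dopen r0 zD).
have RDn : Rect D (cbox n r z) by split=> //; exact: proper_cbox.
have := (is_Dgm_Dgm mufin).2 _ RDn; rewrite (mu_Some mufin RDn) => fin.
apply: sub_finite_set (has_card_finite fin) => c [cp /= zc]; split=> //.
exact: cbox_dpoint.
Qed.

(** The box inequality is applied to a late box about the ball of radius [r]. The thickened box lies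
    in box [m], whose finitely many surplus points outside the larger ball have all been left behind
    by then. *)
Lemma card_Dgm_dball mu nu z r s :
  finite_r_measure D mu -> finite_r_measure D nu ->
  (forall b, proper_rect b -> Rect D (thicken s b) ->
    lenb (mu b) (nu (thicken s b))) ->
  0 <= r -> 0 <= s -> dball z (r + s) `<=` D ->
  copies (Dgm D mu) `&` [set c | dball z r (undec2 c.1)]
    #<= copies (Dgm D nu) `&` [set c | dball z (r + s) (undec2 c.1)].
Proof.
move=> mufin nufin box r0 s0 zD.
have rs0 : 0 <= r + s by exact: addr_ge0.
have nearD := near_cbox_subset Dopen rs0 zD.
have [m mD] := filter_ex nearD.
have RDm : Rect D (cbox m (r + s) z) by split=> //; exact: proper_cbox.
pose N := copies (Dgm D nu) `&` [set c | dpoint_in c.1 (cbox m (r + s) z)].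
have Nfin : finite_set (N `&` [set c | ~ dball z (r + s) (undec2 c.1)]).
  apply: finite_setIl.
  have := (is_Dgm_Dgm nufin).2 _ RDm; rewrite (mu_Some nufin RDm) => fin.
  exact: has_card_finite fin.
have nearN : \forall n \near \oo,
    (\bigcap_(c in N `&` [set c | ~ dball z (r + s) (undec2 c.1)])
      [set n | ~ rect_set (cbox n (r + s) z) (undec2 c.1)]) n.
  by apply: filter_finite_bigI => // c [_]; exact: near_cbox_notin.
have [n [[nD nN] mn]] :=
  filter_ex (filterI (filterI nearD nearN) (nbhs_infty_ge m)).
have RDs : Rect D (cbox n (r + s) z) by split=> //; exact: proper_cbox.
have RDn : Rect D (cbox n r z).
  split; first exact: proper_cbox.
  by apply: subset_trans nD; apply: subset_cbox => //; rewrite lerDl.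
have le : lenb (mu (cbox n r z)) (nu (cbox n (r + s) z)).
  have := box (cbox n r z); rewrite thicken_cbox; apply=> //.
  exact: proper_cbox.
rewrite (mu_Some mufin RDn) (mu_Some nufin RDs) in le.
have cmu := (is_Dgm_Dgm mufin).2 _ RDn; rewrite (mu_Some mufin RDn) in cmu.
have cnu := (is_Dgm_Dgm nufin).2 _ RDs; rewrite (mu_Some nufin RDs) in cnu.
apply: card_le_trans (subset_card_le _).
  apply: card_le_trans (has_card_le cmu cnu le).
  by apply: subset_card_le => c [cp /= zc]; split=> //; exact: cbox_dpoint.
move=> c [cp /= cn]; split=> //; apply: contrapT => nzc.
apply: (nN c); last exact: dpoint_in_rect_set.
by split=> //; split=> //; exact: dpoint_in_subset_cbox cn.
Qed.

(** The fibres are finite because they are the balls of radius 0. *)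
Lemma card_dgm_dball mu z r : finite_r_measure D mu -> dball z r `<=` D ->
  copies (Dgm D mu) `&` [set c | dball z r (undec2 c.1)]
    #= copies (dgm D mu) `&` [set c | dball z r c.1].
Proof.
move=> mufin zD; apply: (@card_dgm R D) => // w Dw.
have := @finite_Dgm_dball mu w 0 mufin (lexx _).
by rewrite dball0; apply=> _ ->.
Qed.

End BallInequality.

(** * Assembling the matching from both directions *)

Theorem theorem4p25 (R : realType) (delta : R) (D : set (\bar R * \bar R))
    (mu : R -> rect R -> natbar)
    (delta_ge0 : 0 <= delta)
    (D_open : open D)
    (mu_finite : forall x : R, 0 <= x <= delta -> finite_r_measure D (mu x))
    (box : forall x y : R, 0 <= x <= delta -> 0 <= y <= delta ->
       forall r : rect R, proper_rect r -> Rect D (thicken `|y - x| r) ->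
       lenb (mu x r) (mu y (thicken `|y - x| r))) :
  exists M : set (((\bar R * \bar R) * nat) * ((\bar R * \bar R) * nat)),
    delta_matching D delta (dgm D (mu 0)) (dgm D (mu delta)) M.
Proof.
pose A t := copies (dgm D (mu t)).
have A_sub t c : 0 <= t <= delta -> A t c -> D c.1.
  move=> _; rewrite /A /copies /= /dgm; case: asboolP => //.
  by move=> /interior_subset.
have A_finite t z r : 0 <= t <= delta -> 0 <= r -> dball z r `<=` D ->
    finite_set (A t `&` [set c | dball z r c.1]).
  move=> /mu_finite tfin r0 zD.
  rewrite -(eq_finite_set (card_dgm_dball D_open tfin zD)).
  exact: finite_Dgm_dball.
have A_le s t z r : 0 <= s <= delta -> 0 <= t <= delta -> 0 <= r ->
    dball z (r + `|t - s|) `<=` D ->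
    (A s `&` [set c | dball z r c.1]
      #<= A t `&` [set c | dball z (r + `|t - s|) c.1])%card.
  move=> sd td r0 zD; have sfin := mu_finite _ sd; have tfin := mu_finite _ td.
  have zrD : dball z r `<=` D.
    by apply: subset_trans zD; apply: le_dball; rewrite lerDl.
  rewrite -(card_le_eql (card_dgm_dball D_open sfin zrD)).
  rewrite -(card_le_eqr (card_dgm_dball D_open tfin zD)).
  by apply: card_Dgm_dball => //; exact: box.
have D_dball z := @near_dball_subset R D z D_open.
have [f [finj fA]] := follow D_dball A_sub A_finite A_le delta_ge0.
have rev t : 0 <= t <= delta -> 0 <= delta - t <= delta.
  by move=> /andP[t0 td]; rewrite subr_ge0 td gerBl.
(* The same argument for the family reversed by [t] to [delta - t]. *)
have [g [ginj gA]] : exists g : (\bar R * \bar R) * nat -> (\bar R * \bar R) * nat,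
    let B0 := A delta `&` [set b | dball b.1 delta `<=` D] in
    set_inj B0 g /\ (forall b, B0 b -> A 0 (g b) /\ dball b.1 delta (g b).1).
  have := @follow R delta D (fun t => A (delta - t)) D_dball.
  rewrite subr0 subrr; apply=> //.
  - by move=> t c /rev; exact: A_sub.
  - by move=> t z r /rev; exact: A_finite.
  - move=> s t z r /rev sd /rev td r0.
    have <- : `|delta - t - (delta - s)| = `|t - s|.
      by rewrite distrC; congr `| _ |; ring.
    exact: A_le.
(* Only points whose [delta]-ball lies in [D] must be matched; their partners under [f] or [g] may
   lie nearer to the complement. *)
have [M [Mfg Ml Mr MA MB]] := matching_merge finj ginj.
(* A ball not contained in [D] has a point of the complement within [delta], which bounds the
   infimum. *)
have exit a : ~ dball a delta `<=` D -> (exit_dist a D <= delta%:E)%E.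
  move=> /existsNP[w /not_implyP[aw nDw]].
  by apply: le_trans aw; apply: ereal_inf_lbound; exists w.
exists M; split.
- move=> [a b] /Mfg[[[Aa aD] ->]|[[Bb bD] ->]]; split=> //=.
    by have [] := fA a.
  by have [] := gA b.
- by split.
- move=> a b /Mfg[[aA ->]|[bB ->]]; first by have [] := fA a.
  by rewrite dinftyC; have [] := gA b.
- by move=> a Aa nM; apply: exit => aD; apply: nM; apply: MA.
- by move=> b Bb nM; apply: exit => bD; apply: nM; apply: MB.
Qed.
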